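(* Let $n\ge 3$ be an integer and let $G=D_{2n}=\langle x,y : x^{n}=y^2=1,\ yxy^{-1}=x^{-1}\rangle$ be the dihedral group of order $2n$. Then the CN-spectrum and CN-energy of the commuting conjugacy class graph $\Gamma(G)$ are $$\text{CN-spec}(\Gamma(G))=\begin{cases} \{(-\frac{1}{2}(n-5))^{\frac{1}{2}(n-3)},\ (\frac{1}{4}(n-3)(n-5))^1,\ 0^1\}, & \text{if } 2\nmid n,\\ \{(-\frac{1}{2}(n-6))^{\frac{1}{2}(n-4)},\ (\frac{1}{4}(n-4)(n-6))^1,\ 0^2\}, & \text{if } 2\mid n, \end{cases}$$ and $$E_{CN}(\Gamma(G))=\begin{cases} \frac{1}{2}(n-3)(n-5), & \text{if } 2\nmid n,\\ \frac{1}{2}(n-4)(n-6), & \text{if } 2\mid n. \end{cases}$$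
   Context: For a finite non-abelian group $G$, the commuting conjugacy class graph $\Gamma(G)$ is the simple undirected graph whose vertices are the conjugacy classes of the non-central elements of $G$; two distinct vertices $a^G$ and $b^G$ are adjacent if there exist $a'\in a^G$, $b'\in b^G$ with $a'b'=b'a'$. For a finite simple graph $\mathcal{G}$ with vertices $v_1,\dots,v_N$, the common neighbourhood matrix $CN(\mathcal{G})$ is the $N\times N$ matrix whose $(i,j)$ entry is, for $i\ne j$, the number of vertices other than $v_i,v_j$ adjacent to both $v_i$ and $v_j$, and is $0$ for $i=j$. The CN-spectrum $\text{CN-spec}(\mathcal{G})$ is the multiset of eigenvalues of $CN(\mathcal{G})$; writing $\{\lambda_1^{\alpha_1},\dots,\lambda_k^{\alpha_k}\}$ means that $\lambda_i$ is listed $\alpha_i$ times (multiplicities of coinciding values add up; entries with exponent $0$ are absent). The CN-energy $E_{CN}(\mathcal{G})$ is the sum of the absolute values of the eigenvalues of $CN(\mathcal{G})$, counted with multiplicity. *)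

(* Defs.v *)
From mathcomp Require Import all_boot all_order all_algebra all_fingroup.
From mathcomp Require Import all_solvable.

Set Implicit Arguments.
Unset Strict Implicit.
Unset Printing Implicit Defensive.

Import GroupScope.

Record sgraph := SGraph {
  svertex :> finType;
  sedge : rel svertex;
  sedge_sym : symmetric sedge;
  sedge_irrefl : irreflexive sedge
}.

Section CommutingConjugacyClassGraph.

Variables (gT : finGroupType) (G : {group gT}).

Definition noncentral_classes : {set {set gT}} :=
  [set a ^: G | a in G :\: 'Z(G)].

Definition ccc_vertex : finType := {A : {set gT} | A \in noncentral_classes}.

Definition ccc_adj : rel ccc_vertex := fun A B =>
  (A != B) && [exists a in val A, [exists b in val B, a * b == b * a]].

Lemma ccc_adj_sym : symmetric ccc_adj.
Proof.
suff sub A B : ccc_adj A B -> ccc_adj B A by move=> A B; apply/idP/idP => /sub.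
case/andP=> neAB /exists_inP[a Aa /exists_inP[b Bb /eqP cab]].
rewrite /ccc_adj eq_sym neAB; apply/exists_inP; exists b => //.
by apply/exists_inP; exists a; rewrite ?cab.
Qed.

Lemma ccc_adj_irrefl : irreflexive ccc_adj.
Proof. by move=> A; rewrite /ccc_adj eqxx. Qed.

Definition ccc_graph : sgraph := SGraph ccc_adj_sym ccc_adj_irrefl.

End CommutingConjugacyClassGraph.

Import GRing.Theory Num.Theory.
Local Open Scope ring_scope.

Definition common_nbrs (Gr : sgraph) (u v : Gr) : {set Gr} :=
  [set w | [&& w != u, w != v, sedge w u & sedge w v]].

(* The vertices are listed in the order of [enum Gr]; the spectrum does not
   depend on this choice. *)
Definition CN_matrix (C : numClosedFieldType) (Gr : sgraph) : 'M[C]_#|Gr| :=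
  \matrix_(i, j)
    if i == j then 0 else #|common_nbrs (enum_val i) (enum_val j)|%:R.

(* The roots of the (monic) characteristic polynomial, listed with their
   multiplicities in an unspecified order: to be compared up to [perm_eq]. *)
Definition eigenvalues (C : numClosedFieldType) (m : nat) (A : 'M[C]_m) :
  seq C := sval (closed_field_poly_normal (char_poly A)).

Definition CN_spec (C : numClosedFieldType) (Gr : sgraph) : seq C :=
  eigenvalues (CN_matrix C Gr).

Definition CN_energy (C : numClosedFieldType) (Gr : sgraph) : C :=
  \sum_(l <- CN_spec C Gr) `|l|.

(* Main.v *)
Require Import Defs.
From mathcomp Require Import all_boot all_order all_algebra all_fingroup.
From mathcomp Require Import all_solvable.
From mathcomp Require Import zify ring.

Set Implicit Arguments.
Unset Strict Implicit.
Unset Printing Implicit Defensive.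

(** The rotation subgroup [H = <[x]>] has index 2 in the dihedral group [G], and
every reflection inverts it. Put [E = {a in H | a ^ 2 = 1}], of order [e = 1]
for odd [n] and [e = 2] for even [n]. A rotation commutes with a reflection only
if it lies in [E], so [E] is the centre of [G]. A rotation outside [E] is
centralised exactly by [H] and has a class of size 2, which gives
[m = (n - e) / 2] rotation classes; a reflection has a class of size [n / e],
which gives [e] reflection classes. Rotations commute with one another, and
non-central rotations never commute with reflections. Hence the graph is a
clique on [m] vertices together with [e <= 2] vertices that are not joined to
the clique.

In such a graph two vertices have common neighbours only if both lie in the
clique, and then [m - 2] of them. With [a] the indicator row of the clique, the
matrix is [c (a^T a - diag a)], where [c = m - 2], so its characteristic matrix
is a diagonal matrix minus a matrix of rank one. The determinant formula
[det_sub_rank1] yields the characteristic polynomial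
[(X + c) ^ (m - 1) * (X - (m - 1) c) * X ^ e] ([char_poly_CN_matrix]), hence the
spectrum and the energy [2 (m - 1) (m - 2)]. Substituting [n = 2 m + e] gives
both parities at once.

The presentation enters only through [dihedral_generators]: the relations bound
the order of [G] by [2 n], and the universal property bounds it below, because
the concrete dihedral group of order [2 n] is then a quotient of [G]. *)

(** * Spectrum of a clique together with at most two other vertices *)

Section Spectrum.
Import GRing.Theory Num.Theory.
Local Open Scope ring_scope.

(** A matrix determinant lemma that avoids inverting [D], so that it applies to
matrices of polynomials: when [v] is an eigenvector of [D] for [d], the factor
[d] on the left replaces the inverse. Both sides equal [d * \det B] for the
block matrix [B] with rows [D v] and [u 1]: clearing its upper right block by
row operations gives the left side, by column operations the right side. *)
Lemma det_sub_rank1 (R : comNzRingType) n (D : 'M[R]_n) (v : 'cV[R]_n)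
    (u : 'rV[R]_n) (d : R) :
  D *m v = d *: v ->
  d * \det (D - v *m u) = \det D * (d - (u *m v) 0 0).
Proof.
move=> Dv; pose B := block_mx D v u (1%:M : 'M_1).
have detB : \det B = \det (D - v *m u).
  have /(congr1 determinant) : block_mx 1%:M (- v) 0 1%:M *m B
      = block_mx (D - v *m u) 0 u 1%:M.
    by rewrite mulmx_block !mul1mx !mul0mx !add0r mulNmx mulmx1 subrr.
  by rewrite det_mulmx det_ublock det_lblock !det1 !mul1r mulr1.
have /(congr1 determinant) : B *m block_mx 1%:M (- v) 0 (d%:M : 'M_1)
    = block_mx D 0 u (d%:M - u *m v).
  rewrite mulmx_block !mulmx1 !mulmx0 !mul1mx !addr0 !mulmxN Dv.
  by rewrite mul_mx_scalar addNr addrC.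
rewrite det_mulmx det_ublock det_lblock det1 mul1r detB det_scalar1 mulrC.
by rewrite [\det (_%:M - _)]det_mx11 !mxE eqxx mulr1n.
Qed.

Lemma eigenvalues_perm (C : numClosedFieldType) m (A : 'M[C]_m) (s : seq C) :
  char_poly A = \prod_(z <- s) ('X - z%:P) -> perm_eq (eigenvalues A) s.
Proof.
rewrite /eigenvalues; case: (closed_field_poly_normal _) => r /= defA defs.
apply: prod_XsubC_eq.
by rewrite -defs [RHS]defA (monicP (char_poly_monic A)) scale1r.
Qed.

Section CliquePlusFew.

Variables (C : numClosedFieldType) (Gr : sgraph) (A : {set Gr}).
Hypothesis cliqueA : {in A &, forall u v, u != v -> sedge u v}.
Hypothesis isolA : {in A & ~: A, forall u v, ~~ sedge u v}.
Hypothesis cardAc : (#|~: A| <= 2)%N.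
Hypothesis cardA : (0 < #|A|)%N.

(** Neighbours of a clique vertex stay in the clique; and two of the at most two
outside vertices leave no third vertex to be a common neighbour. *)
Lemma card_common_nbrs (u v : Gr) : u != v ->
  #|common_nbrs u v| = if (u \in A) && (v \in A) then (#|A| - 2)%N else 0%N.
Proof.
move=> neq_uv; have nbrA w z : z \in A -> sedge w z -> w \in A.
  by move=> Az; apply: contraLR => nAw; rewrite sedge_sym isolA ?inE.
case: ifP => [/andP[Au Av]|nA].
  have -> : common_nbrs u v = A :\: [set u; v].
    apply/setP=> w; rewrite !inE negb_or.
    apply/and4P/andP => [[wu wv ewu _]|[/andP[wu wv] Aw]].
      by rewrite wu wv (nbrA w u).
    by split=> //; apply: cliqueA.
  by rewrite cardsDS ?cards2 ?neq_uv // subUset !sub1set Au.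
apply/eqP; rewrite cards_eq0; apply/eqP/setP=> w; rewrite !inE.
apply: contraFF nA => /and4P[wu wv ewu ewv].
have [Aw|nAw] := boolP (w \in A).
  by rewrite (nbrA u w) ?(nbrA v w) // sedge_sym.
(* Otherwise u, v and w would be three distinct vertices outside A. *)
have nAz z : sedge w z -> z \in ~: A.
  by rewrite inE; apply: contraL => Az; apply: contra nAw => /(nbrA w z Az).
have /subset_leq_card : [set w; u; v] \subset ~: A.
  by rewrite !subUset !sub1set (nAz u) ?(nAz v) // inE nAw.
rewrite -setUA cardsU1 !inE (negPf wu) (negPf wv) cards2 neq_uv.
by move/leq_trans/(_ cardAc).
Qed.

(** Stated with the subtraction of [C]: when the clique has a single vertex the
factor [1 - 2] is negative, but it then only multiplies zeros. *)
Lemma CN_matrixE (i j : 'I_#|Gr|) :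
  let a (k : 'I_#|Gr|) : C := (enum_val k \in A)%:R in
  CN_matrix C Gr i j = (#|A|%:R - 2) * (a i * a j - a i *+ (i == j)).
Proof.
rewrite /= mxE; case: eqVneq => [->|neq_ij].
  by case: (_ \in A); rewrite ?mulr0 ?mul0r ?mulr1 subrr mulr0.
rewrite card_common_nbrs ?(inj_eq enum_val_inj) // mulr0n subr0 -natrM mulnb.
case: andP => [[Ai Aj]|_]; last by rewrite mulr0.
rewrite mulr1 natrB //.
have <- : #|[set enum_val i; enum_val j]| = 2%N.
  by rewrite cards2 (inj_eq enum_val_inj) neq_ij.
by apply: subset_leq_card; rewrite subUset !sub1set Ai.
Qed.

(** The characteristic matrix is [D - v *m u] with [D] diagonal, having entries
['X + c] on the clique and ['X] elsewhere; [v] is supported on the clique, so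
[D] acts on it as the scalar ['X + c]. *)
Lemma char_poly_CN_matrix :
  char_poly (CN_matrix C Gr) =
    ('X - (- (#|A|%:R - 2))%:P) ^+ #|A|.-1 *
    ('X - ((#|A|%:R - 1) * (#|A|%:R - 2))%:P) * 'X ^+ #|~: A|.
Proof.
set c : C := #|A|%:R - 2.
pose a (k : 'I_#|Gr|) : C := (enum_val k \in A)%:R.
pose D : 'M[{poly C}]_#|Gr| := diag_mx (\row_k ('X + (c * a k)%:P)).
pose v : 'cV[{poly C}]_#|Gr| := \col_k (c * a k)%:P.
pose u : 'rV[{poly C}]_#|Gr| := \row_k (a k)%:P.
have aa k : a k * a k = a k by rewrite /a -natrM mulnb andbb.
have defM : char_poly_mx (CN_matrix C Gr) = D - v *m u.
  apply/matrixP=> i j; rewrite !mxE big_ord1 !mxE -/(CN_matrix _ _ i j).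
  have := CN_matrixE i j; rewrite mxE => ->; rewrite -/c -/(a i) -/(a j).
  rewrite !(polyCM, polyCB, polyCMn).
  by case: eqP => [->|_]; rewrite ?mulr1n ?mulr0n; ring.
have Dv : D *m v = ('X + c%:P) *: v.
  apply/matrixP=> i j; rewrite mul_diag_mx !mxE mulrDl [RHS]mulrDl.
  by rewrite -!polyCM mulrACA aa mulrA.
have uv : (u *m v) 0 0 = (c * #|A|%:R)%:P.
  rewrite mxE (eq_bigr (fun k => (c * a k)%:P)); last first.
    by move=> k _; rewrite !mxE -polyCM mulrCA aa.
  rewrite -(rmorph_sum (@polyC C)) /= -mulr_sumr; congr (_ * _)%:P.
  rewrite -(big_enum_val (A := Gr) (fun z => (z \in A)%:R : C)) -natr_sum.
  by rewrite -big_mkcondr sum1_card.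
have detD : \det D = ('X + c%:P) ^+ #|A| * 'X ^+ #|~: A|.
  rewrite det_diag (eq_bigr (fun k => 'X + (c * a k)%:P)); last first.
    by move=> k _; rewrite mxE.
  rewrite -(big_enum_val (A := Gr) (fun z => 'X + (c * (z \in A)%:R)%:P)) /=.
  rewrite (bigID (mem A)) /=; congr (_ * _).
    rewrite (eq_bigr (fun=> 'X + c%:P)) ?prodr_const // => z ->.
    by rewrite mulr1.
  rewrite (eq_bigr (fun=> 'X)) => [|z /negPf->]; last by rewrite mulr0 addr0.
  by rewrite prodr_const; congr (_ ^+ _); apply: eq_card => z; rewrite !inE.
have nzXc : 'X + c%:P != 0 by rewrite monic_neq0 ?monicXaddC.
apply: (mulfI nzXc); rewrite /char_poly defM det_sub_rank1 // detD uv.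
rewrite -{1}(prednK cardA) exprS !(polyCN, polyCM, polyCB) opprK.
by rewrite /c; ring.
Qed.

Lemma CN_spec_clique_isolated :
  perm_eq (CN_spec C Gr)
    (nseq #|A|.-1 (- (#|A|%:R - 2)) ++
     nseq 1 ((#|A|%:R - 1) * (#|A|%:R - 2)) ++ nseq #|~: A| 0).
Proof.
apply: eigenvalues_perm; rewrite char_poly_CN_matrix !big_cat big_seq1 /=.
by rewrite !big_nseq !iter_mulr_1 subr0 mulrA.
Qed.

Lemma CN_energy_clique_isolated :
  CN_energy C Gr = 2 * (#|A|%:R - 1) * (#|A|%:R - 2).
Proof.
rewrite /CN_energy (perm_big _ CN_spec_clique_isolated) !big_cat big_seq1 /=.
rewrite !big_nseq !iter_addr_0 normr0 mul0rn addr0 normrN.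
(* A one-vertex clique is apart: there [#|A| - 2] is negative. *)
case: #|A| cardA => [//|[|m]] _.
  by rewrite subrr mul0r normr0 mulr0 mul0r addr0.
have -> : m.+2%:R - 1 = m.+1%:R :> C by rewrite -[m.+2]addn1 natrD addrK.
have -> : m.+2%:R - 2 = m%:R :> C by rewrite -[m.+2]addn2 natrD addrK.
by rewrite normrM !normr_nat -mulr_natr /=; ring.
Qed.

End CliquePlusFew.
End Spectrum.

(** * Conjugacy classes of a generalised dihedral group *)

Section Groups.
Local Open Scope group_scope.

(** A normal subset is partitioned by the conjugacy classes of its elements. *)
Lemma card_classes_uniform (gT : finGroupType) (G : {group gT}) (S : {set gT})
    k :
    S \subset G -> G \subset 'N(S) -> {in S, forall a, #|a ^: G| = k} ->
  (#|[set a ^: G | a in S]| * k)%N = #|S|.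
Proof.
move=> sSG nSG cardS.
rewrite (@card_uniform_partition _ k [set a ^: G | a in S] S) //.
  by move=> _ /imsetP[a Sa ->]; apply: cardS.
have -> : [set a ^: G | a in S] = orbit 'J G @: S by [].
by apply: orbit_partition; rewrite astabsJ.
Qed.

Section GeneralizedDihedral.

Variables (gT : finGroupType) (G H : {group gT}).
Hypothesis sHG : H \subset G.
Hypothesis abelH : abelian H.
Hypothesis indexH : #|G : H| = 2.
Hypothesis invH : {in H & G :\: H, forall a b, a ^ b = a^-1}.

Let E := [set a in H | a ^+ 2 == 1].
Hypothesis exists_noninvol : E != H.

Lemma sq_eq1 (a : gT) : (a ^+ 2 == 1) = (a^-1 == a).
Proof. by rewrite expgS expg1 -eq_invg_mul. Qed.

Lemma sq_eq1_sub : E \subset H.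
Proof. by apply/subsetP=> a; rewrite inE => /andP[]. Qed.

Let nHG : H <| G := index2_normal sHG indexH.

(** Conjugation by [b] inverts [a], so they commute iff [a] is its own
inverse. *)
Lemma cent_rotation_reflection a b :
  a \in H -> b \in G :\: H -> (a \in 'C[b]) = (a \in E).
Proof.
move=> Ha Hb; rewrite [RHS]inE Ha /= sq_eq1 -(invH Ha Hb).
by apply/cent1P/eqP => [/commgP/conjg_fixP|/conjg_fixP/commgP].
Qed.

Lemma reflection_exists : exists b, b \in G :\: H.
Proof.
by apply/set0Pn; rewrite setD_eq0 -indexg_eq1 indexH.
Qed.

Lemma cent1_rotation a : a \in H :\: E -> 'C_G[a] = H.
Proof.
case/setDP=> Ha nEa; apply/setP=> b; apply/setIP/idP => [[Gb ab]|Hb].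
  apply: contraR nEa => nHb; rewrite -(cent_rotation_reflection Ha (b := b)).
    by rewrite cent1C.
  by rewrite inE nHb.
by rewrite (subsetP sHG) // cent1C; split=> //; apply/cent1P/(centsP abelH).
Qed.

(** A reflection cannot be central: it would centralise [H], forcing [E = H]. *)
Lemma center_gen_dihedral : 'Z(G) = E.
Proof.
have [b Hb] := reflection_exists.
apply/setP=> a; apply/idP/idP => [/centerP[Ga cGa]|Ea].
  have [Ha|nHa] := boolP (a \in H).
    rewrite -(cent_rotation_reflection Ha Hb); apply/cent1P/cGa.
    by case/setDP: Hb.
  case/negP: exists_noninvol; rewrite eqEsubset sq_eq1_sub /=.
  have GHa : a \in G :\: H by rewrite inE nHa.
  apply/subsetP=> z Hz; rewrite -(cent_rotation_reflection Hz GHa).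
  by apply/cent1P/commute_sym/cGa/(subsetP sHG).
have Ha : a \in H by move: Ea; rewrite inE => /andP[].
apply/centerP; split=> [|z Gz]; first exact: (subsetP sHG).
have [Hz|nHz] := boolP (z \in H); first exact: (centsP abelH).
by apply/cent1P; rewrite cent_rotation_reflection // inE nHz.
Qed.

Lemma card_class_rotation a : a \in H :\: E -> #|a ^: G| = 2.
Proof. by move=> HEa; rewrite -index_cent1 cent1_rotation. Qed.

(** The maximality of [H] gives [H * C = G] for the centraliser [C] of [b],
while [H :&: C = E]; counting [H * C] then determines [#|C|]. *)
Lemma card_class_reflection b :
  b \in G :\: H -> (#|b ^: G| * #|E|)%N = #|H|.
Proof.
move=> Hb; have [Gb nHb] := setDP Hb.
have defG : (H * 'C_G[b])%g = G.
  apply: mulg_normal_maximal; rewrite ?subsetIl ?p_index_maximal ?indexH //.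
  by apply/subsetPn; exists b; rewrite // inE Gb cent1id.
have defE : H :&: 'C_G[b] = E.
  apply/setP=> a; rewrite setIA (setIidPl sHG) inE.
  have [Ha|/negPf nHa] := boolP (a \in H); last by rewrite [RHS]inE nHa.
  exact: cent_rotation_reflection.
have := mul_cardG H 'C_G[b]; rewrite defG /= defE.
rewrite -(Lagrange (subsetIl G 'C[b])) index_cent1 -mulnA mulnC.
by move/eqP; rewrite eqn_pmul2l ?cardG_gt0 // => /eqP.
Qed.

Lemma card_rotation_classes :
  (#|[set a ^: G | a in H :\: E]| * 2 + #|E|)%N = #|H|.
Proof.
rewrite (card_classes_uniform _ _ card_class_rotation).
- by rewrite cardsDS ?subnK ?subset_leq_card ?sq_eq1_sub.
- by rewrite subDset subsetU // sHG orbT.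
by rewrite -center_gen_dihedral normsD ?normal_norm ?center_normal.
Qed.

(** All reflection classes have size [#|H| / #|E|], and together they fill
[G :\: H], which has as many elements as [H]. *)
Lemma card_reflection_classes : #|[set b ^: G | b in G :\: H]| = #|E|.
Proof.
have [b0 Hb0] := reflection_exists.
have cardGH : #|G :\: H| = #|H|.
  by rewrite cardsDS // -(Lagrange sHG) indexH muln2 -addnn addnK.
have E0 : 0 < #|E| by rewrite -center_gen_dihedral cardG_gt0.
have cardC : {in G :\: H, forall b, #|b ^: G| = (#|H| %/ #|E|)%N}.
  by move=> b Hb; rewrite -(card_class_reflection Hb) mulnK.
have := card_classes_uniform (subsetDl G H) _ cardC.
rewrite cardGH normsD ?normG ?normal_norm // => /(_ isT).
rewrite -(cardC _ Hb0) -{1}(card_class_reflection Hb0) mulnC => /eqP.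
by rewrite eqn_pmul2l -?index_cent1 // => /eqP.
Qed.

Definition rotation_classes : {set ccc_graph G} :=
  [set v : ccc_vertex G | val v \subset H].

Lemma class_sub_rotations a : (a ^: G \subset H) = (a \in H).
Proof. by rewrite class_sub_norm ?normal_norm. Qed.

Lemma rotation_classesP (v : ccc_vertex G) :
  reflect (exists2 a, a \in H :\: E & val v = a ^: G) (v \in rotation_classes).
Proof.
rewrite inE; apply: (iffP idP) => [|[a /setDP[Ha _] ->]]; last first.
  by rewrite class_sub_rotations.
case/imsetP: (valP v) => a; rewrite center_gen_dihedral => /setDP[_ nEa] ->.
by rewrite class_sub_rotations => Ha; exists a; rewrite // inE nEa.
Qed.

Lemma reflection_classesP (v : ccc_vertex G) :
  reflect (exists2 b, b \in G :\: H & val v = b ^: G)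
    (v \notin rotation_classes).
Proof.
rewrite inE; apply: (iffP idP) => [|[b /setDP[_ nHb] ->]]; last first.
  by rewrite class_sub_rotations.
case/imsetP: (valP v) => b /setDP[Gb _] ->.
by rewrite class_sub_rotations => nHb; exists b; rewrite // inE nHb.
Qed.

Lemma card_vertices (V : {set ccc_graph G}) (S : {set gT}) :
    S \subset G :\: 'Z(G) ->
    (forall v : ccc_vertex G,
       reflect (exists2 a, a \in S & val v = a ^: G) (v \in V)) ->
  #|V| = #|[set a ^: G | a in S]|.
Proof.
move=> sSG VP; have val_injG : injective (val : ccc_vertex G -> {set gT}).
  exact: val_inj.
rewrite -(card_imset _ val_injG).
apply: eq_card => X; apply/imsetP/imsetP => [[v /VP[a Sa ->] ->] | [a Sa ->]].
  by exists a.
have Va : a ^: G \in noncentral_classes G by apply/imset_f/(subsetP sSG).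
by exists (Sub (a ^: G) Va : ccc_vertex G) => //; apply/VP; exists a.
Qed.

Lemma card_rotation_vertices : (#|rotation_classes| * 2 + #|E|)%N = #|H|.
Proof.
by rewrite (card_vertices _ rotation_classesP) ?card_rotation_classes //
  center_gen_dihedral setSD.
Qed.

Lemma card_reflection_vertices : #|~: rotation_classes| = #|E|.
Proof.
rewrite (@card_vertices _ (G :\: H)) ?card_reflection_classes //.
  by rewrite center_gen_dihedral setDS ?sq_eq1_sub.
by move=> v; rewrite inE; apply: reflection_classesP.
Qed.

Lemma rotation_classes_clique :
  {in rotation_classes &, forall u v, u != v -> sedge u v}.
Proof.
move=> u v; rewrite !inE => /subsetP uH /subsetP vH neq_uv.
rewrite /= /ccc_adj neq_uv /=.
case/imsetP: (valP u) => a _ defu.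
case/imsetP: (valP v) => b _ defv.
have ua : a \in val u by rewrite defu class_refl.
have vb : b \in val v by rewrite defv class_refl.
apply/exists_inP; exists a => //; apply/exists_inP; exists b => //.
by apply/eqP/(centsP abelH); [apply: uH | apply: vH].
Qed.

(** The sets of non-central rotations and of reflections are normal, so the
obstruction found for single elements applies to every pair of conjugates. *)
Lemma rotation_classes_isolated :
  {in rotation_classes & ~: rotation_classes, forall u v, ~~ sedge u v}.
Proof.
move=> u v /rotation_classesP[a HEa defu]; rewrite inE.
case/reflection_classesP=> b GHb defv; apply/negP.
have nGHE : G \subset 'N(H :\: E).
  by rewrite -center_gen_dihedral normsD ?normal_norm ?center_normal.
have nGGH : G \subset 'N(G :\: H) by rewrite normsD ?normG ?normal_norm.
case/andP=> _ /exists_inP[a' ua' /exists_inP[b' vb' /eqP cab]].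
have HEa' : a' \in H :\: E.
  by apply: subsetP ua'; rewrite defu class_sub_norm.
have GHb' : b' \in G :\: H.
  by apply: subsetP vb'; rewrite defv class_sub_norm.
have [Ha' /negP[]] := setDP HEa'.
by rewrite -(cent_rotation_reflection Ha' GHb'); apply/cent1P.
Qed.

End GeneralizedDihedral.

(** * The dihedral group *)

(** The relations give [G = <[x]> * <[y]>] with [#[x] <= n] and [#[y] <= 2];
since [G] maps onto the dihedral group of order [2 n], these bounds are
equalities and the two cyclic groups meet trivially. *)
Lemma dihedral_generators (n : nat) (gT : finGroupType) (G : {group gT}) :
    1 < n -> G \isog Grp (x : y : x ^+ n, y ^+ 2, y * x * y^-1 = x^-1) ->
  exists x, [/\ <[x]> \subset G, #[x] = n, #|G : <[x]>| = 2
    & {in <[x]> & G :\: <[x]>, forall a b, a ^ b = a^-1}].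
Proof.
move=> n1 isoG.
have /existsP[[x y] /= /eqP[defG xn y2 yxy]] := isoGrp_hom isoG.
have xy : x ^ y = x^-1.
  have yV : y^-1 = y by apply/eqP; rewrite eq_invg_mul -expg2 y2.
  by rewrite -yxy conjgE yV mulgA.
have xyi i : (x ^+ i) ^ y = (x ^+ i)^-1 by rewrite conjXg xy expgVn.
have ord_x : #[x] <= n by rewrite dvdn_leq ?order_dvdn ?xn // ltnW.
have ord_y : #[y] <= 2 by rewrite dvdn_leq ?order_dvdn ?y2.
have nxy : <[y]> \subset 'N(<[x]>).
  by rewrite cycle_subG; apply/normP; rewrite -cycleJ xy cycleV.
have dG : <[x]> * <[y]> = G by rewrite -norm_joinEr // joing_idl joing_idr.
have cardG_ge : n.*2 <= #|G|.
  rewrite -[X in X <= _](card_dihedral n1).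
  apply: dvdn_leq => //; apply: card_homg; rewrite isoG.
  have /existsP[[u v] /= /eqP[defD un v2 uv]] := isoGrp_hom (Grp_dihedral n1).
  have vV : v^-1 = v by apply/eqP; rewrite eq_invg_mul -expg2 v2.
  apply/existsP; exists (u, v); rewrite /= !xpair_eqE defD un v2 -uv.
  by rewrite conjgE vV !mulgA !eqxx.
have cardG : (#|G| * #|<[x]> :&: <[y]>|)%N = (#[x] * #[y])%N.
  by rewrite -dG mul_cardG.
have I1 : (0 < #|<[x]> :&: <[y]>|)%N by exact: cardG_gt0.
have ox : #[x] = n by nia.
have oG : #|G| = n.*2 by nia.
have sxG : <[x]> \subset G by rewrite -dG mulG_subl.
have ix : #|G : <[x]>| = 2.
  by rewrite -divgS // oG -orderE ox -muln2 mulKn // ltnW.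
exists x; split=> // _ b /cycleP[i ->] /setDP[Gb nxb].
move: Gb nxb; rewrite -dG => /mulsgP[_ _ /cycleP[j ->] /cycleP[k ->] ->].
rewrite groupMl ?mem_cycle // => nk.
have -> : y ^+ k = y.
  rewrite -(expg_mod k y2).
  case: (k %% 2) (ltn_mod k 2) (expg_mod k y2) => [|[|//]] // _ yk.
  by case/negP: nk; rewrite -yk expg0.
rewrite conjgM -xyi; congr (_ ^ _).
by apply/conjg_fixP/commgP/commuteX2.
Qed.

Lemma card_sq_eq1_cycle (gT : finGroupType) (x : gT) :
  #|[set a in <[x]> | a ^+ 2 == 1]| = (if odd #[x] then 1 else 2)%N.
Proof.
case: ifP => ox.
  have -> : [set a in <[x]> | a ^+ 2 == 1] = [set 1].
    apply/setP=> a; rewrite !inE; apply/andP/eqP => [[xa a2]|->].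
      apply/eqP; rewrite -order_eq1 -dvdn1.
      have /eqP <- : coprime 2 #[x] by rewrite coprime2n ox.
      by rewrite dvdn_gcd order_dvdn a2 order_dvdG.
    by rewrite group1 expg1n.
  by rewrite cards1.
have x2 : #[x] = (#[x]./2 * 2)%N by rewrite muln2 -[LHS]odd_double_half ox.
have x0 : 0 < #[x]./2 by have := order_gt0 x; lia.
have -> : [set a in <[x]> | a ^+ 2 == 1] = [set 1; x ^+ #[x]./2].
  apply/setP=> a; rewrite !inE; apply/andP/orP => [[/cyclePmin[i ltix ->]]|].
    rewrite -expgM -order_dvdn => /dvdnP[k ik].
    have : (k = 0 \/ k = 1)%N by nia.
    case=> kE; rewrite kE in ik; [left | right].
      by have -> : i = 0%N by lia.
    by have <- : i = #[x]./2 by lia.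
  case=> /eqP->; first by rewrite group1 expg1n.
  by rewrite mem_cycle -expgM -x2 expg_order.
rewrite cards2 eq_sym -order_dvdn gtnNdvd //; lia.
Qed.

End Groups.

Import GRing.Theory Num.Theory.

Theorem theorem2p2 (C : numClosedFieldType) (n : nat) (hn : (3 <= n)%N)
    (gT : finGroupType) (G : {group gT})
    (hG : (G \isog Grp (x : y : x ^+ n, y ^+ 2, y * x * y^-1 = x^-1))%g) :
  (perm_eq (CN_spec C (ccc_graph G))
     (if odd n
      then nseq ((n - 3) %/ 2)%N (- (1 / 2 * (n%:R - 5)))
             ++ nseq 1 (1 / 4 * (n%:R - 3) * (n%:R - 5)) ++ nseq 1 0
      else nseq ((n - 4) %/ 2)%N (- (1 / 2 * (n%:R - 6)))
             ++ nseq 1 (1 / 4 * (n%:R - 4) * (n%:R - 6)) ++ nseq 2 0) /\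
   CN_energy C (ccc_graph G) =
     (if odd n
      then 1 / 2 * (n%:R - 3) * (n%:R - 5)
      else 1 / 2 * (n%:R - 4) * (n%:R - 6)))%R.
Proof.
have [x [sxG ox ix invx]] := dihedral_generators (ltnW hn) hG.
have abx := cycle_abelian x.
pose e := #|[set a in <[x]> | a ^+ 2 == 1]%g|.
have eE : e = if odd n then 1%N else 2%N by rewrite /e card_sq_eq1_cycle ox.
have neE : [set a in <[x]> | a ^+ 2 == 1]%g != <[x]>%g.
  by apply: contraTneq hn => Ex; rewrite -ox /order -Ex -/e eE; case: odd.
have cA := card_rotation_vertices sxG abx ix invx neE.
have cAc := card_reflection_vertices sxG abx ix invx neE.
have clA := @rotation_classes_clique _ G _ abx.
have isA := rotation_classes_isolated sxG abx ix invx neE.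
rewrite -/e -[#|<[x]>%g|]/#[x]%g ox in cA cAc.
set A := rotation_classes _ _ in cA cAc clA isA.
have cAc2 : (#|~: A| <= 2)%N by rewrite cAc eE; case: odd.
have A0 : (0 < #|A|)%N.
  by move: cA; rewrite eE; have := odd_double_half n; case: odd; lia.
rewrite (CN_energy_clique_isolated C clA isA cAc2 A0).
have := CN_spec_clique_isolated C clA isA cAc2 A0; rewrite cAc.
have nE : (n%:R = 2 * #|A|%:R + e%:R :> C)%R by rewrite -cA natrD natrM mulrC.
have c1 : (((n - e.+2) %/ 2) = #|A|.-1)%N by rewrite -cA; lia.
move: c1; rewrite nE eE.
case: odd => /= -> specA.
  have -> : (1 / 2 * (2 * #|A|%:R + 1 - 5) = #|A|%:R - 2 :> C)%R by field.
  have -> : (1 / 4 * (2 * #|A|%:R + 1 - 3) * (2 * #|A|%:R + 1 - 5)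
      = (#|A|%:R - 1) * (#|A|%:R - 2) :> C)%R by field.
  by split=> //; field.
have -> : (1 / 2 * (2 * #|A|%:R + 2 - 6) = #|A|%:R - 2 :> C)%R by field.
have -> : (1 / 4 * (2 * #|A|%:R + 2 - 4) * (2 * #|A|%:R + 2 - 6)
    = (#|A|%:R - 1) * (#|A|%:R - 2) :> C)%R by field.
by split=> //; field.
Qed.
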